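(* The FIFO Stack-Up problem can be solved in time $O(k\cdot (N+1)^k)$.
   Context: FIFO Stack-Up problem. An instance consists of a list $Q=(q_1,\ldots,q_k)$ of $k$ sequences of pairwise distinct bins, a pallet symbol ${\it plt}(b)$ (a positive integer) for every bin $b$, and a positive integer $p$. Standing assumption: every pallet symbol that occurs is carried by at least two bins. A configuration is a tuple $(i_1,\ldots,i_k)$ with $0\le i_j\le |q_j|$, meaning that the first $i_j$ bins of $q_j$ have been removed. A pallet $t$ is open in configuration $(i_1,\ldots,i_k)$ if there are indices $j,\ell$ such that some bin for $t$ is at a position $\le i_j$ in $q_j$ and some bin for $t$ is at a position $> i_\ell$ in $q_\ell$. A transformation step removes the bin at position $i_j+1$ of some sequence $q_j$ (with $i_j<|q_j|$). A processing of $Q$ is a sequence of transformation steps from $(0,\ldots,0)$ to $(|q_1|,\ldots,|q_k|)$. The question is whether there is a processing of $Q$ such that in each configuration during the processing at most $p$ pallets are open. $N=\max\{|q_1|,\ldots,|q_k|\}$. *)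

(* Defs.v *)
From HB Require Import structures.
From mathcomp Require Import all_boot.

Set Implicit Arguments.
Unset Strict Implicit.
Unset Printing Implicit Defensive.

(** * The FIFO Stack-Up problem *)

(** [bin] is an arbitrary type; the bins of the instance are those that occur
    in the sequences, and they are pairwise distinct across all sequences. *)
Record instance := Instance {
  bin : eqType;
  nseqs : nat;
  seqs : nseqs.-tuple (seq bin);
  plt : bin -> nat;
  places : nat;
  nseqs_gt0 : 0 < nseqs;
  places_gt0 : 0 < places;
  bins_uniq : uniq (flatten seqs);
  plt_gt0 : forall b, b \in flatten seqs -> 0 < plt b;
  plt_twice : forall b, b \in flatten seqs ->
    1 < count (fun b' => plt b' == plt b) (flatten seqs)
}.

Section Problem.
Variable I : instance.
Local Notation k := (nseqs I).

Definition sq (j : 'I_k) : seq (bin I) := tnth (seqs I) j.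

Definition maxlen : nat := \max_(j < k) size (sq j).

(** The entry at [j] is the number of bins already removed from [sq j]. *)
Definition configuration := {ffun 'I_k -> nat}.

Definition initial : configuration := [ffun=> 0].
Definition final : configuration := [ffun j => size (sq j)].

Definition pallets : seq nat := undup [seq plt b | b <- flatten (seqs I)].

Definition is_open (c : configuration) (t : nat) : bool :=
  [exists j : 'I_k, exists l : 'I_k,
    (t \in [seq plt b | b <- take (c j) (sq j)]) &&
    (t \in [seq plt b | b <- drop (c l) (sq l)])].

Definition num_open (c : configuration) : nat := count (is_open c) pallets.

Definition transformation_step : rel configuration := fun c c' =>
  [exists j : 'I_k, (c j < size (sq j)) &&
    (c' == [ffun l => if l == j then (c l).+1 else c l])].

(** [s] lists the configurations visited after [initial]. *)
Definition is_processing (s : seq configuration) : bool :=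
  path transformation_step initial s && (last initial s == final).

Definition has_processing : Prop :=
  exists s : seq configuration,
    is_processing s /\ all (fun c => num_open c <= places I) (initial :: s).

(** A bin is identified by its place in the word, which gives its pallet
    symbol: [k, p, |q_1|, plt(q_1), ..., |q_k|, plt(q_k)]. *)
Definition encode : seq nat :=
  [:: k, places I & flatten
    [seq size q :: [seq plt b | b <- q] | q : seq (bin I) <- seqs I]].

End Problem.

(** * Unit-cost random access machines

    The machine of Cook and Reckhow, with registers in [nat] and truncated
    subtraction.  There is deliberately no multiplication, shift or bitwise
    instruction: under unit cost these would allow massive parallelism inside
    a single register, whereas here an arithmetic step lengthens the binary
    representation of the largest value by at most one bit. *)

Inductive instr :=
| Const of nat & nat         (* X_r := n *)
| Add of nat & nat & nat     (* X_r := X_s + X_t *)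
| Sub of nat & nat & nat     (* X_r := X_s - X_t *)
| LoadInd of nat & nat       (* X_r := X_(X_s) *)
| StoreInd of nat & nat      (* X_(X_r) := X_s *)
| JumpPos of nat & nat       (* if 0 < X_r then goto l *)
| Read of nat                (* X_r := next input number, 0 past the end *)
| Accept
| Reject.

Definition program := seq instr.

Record state := State { pc : nat; reg : nat -> nat; input : seq nat }.

Definition start (w : seq nat) : state := State 0 (fun=> 0) w.

Definition upd (m : nat -> nat) (r v : nat) : nat -> nat :=
  fun x => if x == r then v else m x.

Definition exec (i : instr) (st : state) : state + bool :=
  let: State a m w := st in
  match i with
  | Const r n => inl (State a.+1 (upd m r n) w)
  | Add r s t => inl (State a.+1 (upd m r (m s + m t)) w)
  | Sub r s t => inl (State a.+1 (upd m r (m s - m t)) w)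
  | LoadInd r s => inl (State a.+1 (upd m r (m (m s))) w)
  | StoreInd r s => inl (State a.+1 (upd m (m r) (m s)) w)
  | JumpPos r l => inl (State (if 0 < m r then l else a.+1) m w)
  | Read r => inl (State a.+1 (upd m r (head 0 w)) (behead w))
  | Accept => inr true
  | Reject => inr false
  end.

(** [run P n st = Some b] iff [P], started in [st], halts with answer [b]
    after executing at most [n] instructions (the halting one included).  A
    machine whose program counter leaves the program never answers. *)
Fixpoint run (P : program) (n : nat) (st : state) : option bool :=
  if n is n'.+1 then
    if onth P (pc st) is Some i then
      match exec i st with
      | inl st' => run P n' st'
      | inr b => Some b
      end
    else None
  else None.

(* Main.v *)
(** Depth-first search over the configurations that are reachable with at most
    [p] open pallets.  The machine updates by increments the number of bins
    removed from each sequence and for each pallet, the number of open pallets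
    and the mixed-radix index of the current configuration, so that following
    an edge of the search graph, or retracting one, costs O(1) instructions.
    There are at most (N+1)^k configurations with k outgoing edges each, and
    reading the input costs O(k(N+1)).  Registers addressed by a configuration
    index or by a pallet symbol serve as random-access tables. *)

Require Import Defs.
From mathcomp Require Import all_boot zify.

Set Implicit Arguments.
Unset Strict Implicit.
Unset Printing Implicit Defensive.

(** * A structured language compiled to the machine *)

(** The machine offers only jumps and flat registers, so the program is written in a small
    imperative language with arrays, and its compiler is verified together with instruction counts.
    The cost of a loop-free command is read off its syntax, independently of the store; a time bound
    then reduces to counting loop turns, and [C] does not depend on the instance. The search is a
    single loop with a loop-free body and an explicit stack; a potential, [work], drops in every
    turn. In the absence of multiplication, strides are accumulated by one addition per bin during
    input, and array addresses are formed by doubling. Rejection is correct because an exhausted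
    search leaves a visited set closed under the steps out of good configurations, while a good
    final configuration would have stopped the loop. The potential charges [k.+1] per configuration,
    one unit for entering it and one per edge; this is at most [2 * k] since [k] is positive. *)

Definition reaches (P : program) (n : nat) (st st' : state) : Prop :=
  exists2 n', n' <= n & forall f, run P (n' + f) st = run P f st'.

Lemma reaches_refl P st : reaches P 0 st st.
Proof. by exists 0. Qed.

(** The exact number of steps is hidden below the bound and the remaining fuel is arbitrary, so runs
    compose by adding bounds. *)
Lemma reaches_trans P n1 n2 st1 st2 st3 :
  reaches P n1 st1 st2 -> reaches P n2 st2 st3 -> reaches P (n1 + n2) st1 st3.
Proof.
move=> [m1 le1 run1] [m2 le2 run2]; exists (m1 + m2); first exact: leq_add.
by move=> f; rewrite -addnA run1 run2.
Qed.

Lemma reaches_leq P n n' st st' :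
  n <= n' -> reaches P n st st' -> reaches P n' st st'.
Proof. by move=> le_n [m le_m E]; exists m => //; apply: leq_trans le_n. Qed.

Lemma reaches_step P i st st' :
  onth P (pc st) = Some i -> exec i st = inl st' -> reaches P 1 st st'.
Proof. by move=> Pi ei; exists 1 => // f; rewrite /= Pi ei. Qed.

Lemma run_leq P n n' st b : n <= n' -> run P n st = Some b -> run P n' st = Some b.
Proof.
elim: n n' st => // n IHn [//|n'] st; rewrite ltnS => le_n /=.
by case: onth => // i; case: exec => // st' /IHn->.
Qed.

Fixpoint code_at (P : program) (a : nat) (s : seq instr) : Prop :=
  if s is i :: s' then onth P a = Some i /\ code_at P a.+1 s' else True.

Lemma code_at_cat P a s1 s2 :
  code_at P a (s1 ++ s2) <-> code_at P a s1 /\ code_at P (a + size s1) s2.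
Proof.
elim: s1 a => [|i s1 IHs] a /=; first by rewrite addn0; split=> [|[]].
by rewrite IHs addSnnS; tauto.
Qed.

Lemma code_at_suffix P s : code_at (P ++ s) (size P) s.
Proof.
elim: s P => //= i s IHs P; split; last by rewrite -cat_rcons -(size_rcons P i).
by rewrite onthE map_cat nth_cat size_map ltnn subnn.
Qed.

(** * Source language, memory layout and compiler *)

Inductive expr :=
| Num of nat
| Var of nat
| Plus of expr & expr
| Minus of expr & expr
| Arr of nat & expr.

Inductive cmd :=
| Assign of nat & expr
| Store of nat & expr & expr
| Input of nat
| Seq of cmd & cmd
| If of expr & cmd & cmd
| While of expr & cmd.

Record store := Sto { sc : nat -> nat; ar : nat -> nat -> nat; inp : seq nat }.

Definition set_sc (s : store) r v := Sto (upd (sc s) r v) (ar s) (inp s).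

Definition set_ar (s : store) a i v :=
  Sto (sc s)
    (fun a' i' => if (a' == a) && (i' == i) then v else ar s a' i') (inp s).

Fixpoint eval (s : store) (e : expr) : nat :=
  match e with
  | Num n => n
  | Var r => sc s r
  | Plus e1 e2 => eval s e1 + eval s e2
  | Minus e1 e2 => eval s e1 - eval s e2
  | Arr a e => ar s a (eval s e)
  end.

Definition var_bound := 16.
Definition array_bound := 32.

(** The entry [i] of the array [a] is kept in the register [32 * i + 32 + a];
    the variables are the registers below 16, and the registers from 16 to 31
    serve to evaluate expressions. *)
Definition sim (s : store) (m : nat -> nat) : Prop :=
  (forall r, r < var_bound -> m r = sc s r) /\
  (forall a i, a < array_bound -> m (32 * i + 32 + a) = ar s a i).

(** Five doublings replace a multiplication by 32; this is why the number of interleaved arrays is a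
    power of two. *)
Definition address (a d d' : nat) : seq instr :=
  nseq 5 (Add d d d) ++ [:: Const d' (32 + a); Add d d d'].

Arguments address : simpl never.

Fixpoint compile_expr (e : expr) (d : nat) : seq instr :=
  match e with
  | Num n => [:: Const d n]
  | Var r => [:: Const d 0; Add d d r]
  | Plus e1 e2 =>
      compile_expr e1 d ++ compile_expr e2 d.+1 ++ [:: Add d d d.+1]
  | Minus e1 e2 =>
      compile_expr e1 d ++ compile_expr e2 d.+1 ++ [:: Defs.Sub d d d.+1]
  | Arr a e => (compile_expr e d ++ address a d d.+1) ++ [:: LoadInd d d]
  end.

(** Evaluation uses the registers from [d] on as a stack, which must stay below the array cells.
    [Arr] asks for [d < 31] because [address] also writes to [d.+1]. *)
Fixpoint wf_expr (e : expr) (d : nat) : bool :=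
  match e with
  | Num _ => d < 32
  | Var r => (r < var_bound) && (d < 32)
  | Plus e1 e2 | Minus e1 e2 => wf_expr e1 d && wf_expr e2 d.+1
  | Arr a e => [&& a < array_bound, d < 31 & wf_expr e d]
  end.

Lemma wf_expr_lt e d : wf_expr e d -> d < 32.
Proof.
elim: e d => [n|r|e1 IH1 e2 _|e1 IH1 e2 _|a e _] d //=.
- by case/andP.
- by case/andP=> /IH1.
- by case/andP=> /IH1.
- by case/and3P=> _ /ltnW.
Qed.

Definition straight (i : instr) : bool :=
  if i is (JumpPos _ _ | Accept | Reject) then false else true.

Definition exec_seq (s : seq instr) (st : state) : state :=
  foldl (fun st i => if exec i st is inl st' then st' else st) st s.

Lemma reaches_exec_seq P s st :
  all straight s -> code_at P (pc st) s -> reaches P (size s) st (exec_seq s st).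
Proof.
elim: s st => [|i s IHs] st /=; first by move=> *; exact: reaches_refl.
move=> /andP[si ss] [Pi Ps]; rewrite -add1n.
have [st' ei pc_st'] : exists2 st', exec i st = inl st' & pc st' = (pc st).+1.
  by case: i st si {Pi Ps} => [r n|r t u|r t u|r t|r t|r l|r||] [a m w] //= _;
    eexists; reflexivity.
rewrite ei; apply: reaches_trans (reaches_step Pi ei) _.
by apply: IHs; rewrite ?pc_st'.
Qed.

(** Below [d] lie the variables and the pending intermediate results, from 32 on the arrays: an
    evaluation into [d] may disturb neither. *)
Definition agree (d : nat) (m m' : nat -> nat) : Prop :=
  forall r, (r < d) || (32 <= r) -> m' r = m r.

Lemma agree_sim s d m m' : 15 < d -> agree d m m' -> sim s m -> sim s m'.
Proof.
move=> lt_d eqm [simv sima]; split=> [r lt_r|a i lt_a]; rewrite eqm; auto.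
  by rewrite (leq_trans lt_r).
by rewrite addnAC leq_addl orbT.
Qed.

Lemma agree_trans d d' m1 m2 m3 :
  d <= d' -> agree d m1 m2 -> agree d' m2 m3 -> agree d m1 m3.
Proof. by move=> le_d A12 A23 r lt_r; rewrite A23 ?A12 //; lia. Qed.

Lemma exec_address t d d' a m w :
    d != d' ->
  exists m', [/\ exec_seq (address t d d') (State a m w) = State (a + 7) m' w,
    m' d = 32 * m d + 32 + t &
    forall r, r != d -> r != d' -> m' r = m r].
Proof.
move=> /negbTE ne_d; rewrite addnC /address /exec_seq /=; eexists; split; first reflexivity.
  by rewrite /upd !eqxx ne_d; lia.
by move=> r /negbTE rd /negbTE rd'; rewrite /upd rd rd'.
Qed.

Lemma exec_seq_cat s1 s2 st : exec_seq (s1 ++ s2) st = exec_seq s2 (exec_seq s1 st).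
Proof. exact: foldl_cat. Qed.

Lemma straight_expr e d : all straight (compile_expr e d).
Proof.
by elim: e d => //= [e1 I1 e2 I2|e1 I1 e2 I2|t e I] d; rewrite !all_cat ?I1 ?I2 ?I.
Qed.

(** The value of a first operand waits in [d] while the second is evaluated into [d.+1], and
    [agree d.+1] guarantees that it survives. *)
Lemma exec_expr s e d a m w :
    15 < d -> wf_expr e d -> sim s m ->
  exists m', [/\ exec_seq (compile_expr e d) (State a m w)
                   = State (a + size (compile_expr e d)) m' w,
    agree d m m' & m' d = eval s e].
Proof.
elim: e d a m => [n|r|e1 IH1 e2 IH2|e1 IH1 e2 IH2|t e IH] d a m gt_d /=.
- move=> lt_d sm; rewrite addn1; eexists; split; first reflexivity.
    by move=> r; rewrite /upd; case: eqP => //; lia.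
  by rewrite /upd eqxx.
- move=> /andP[lt_r lt_d] sm; rewrite addn2; eexists; split; first reflexivity.
    by move=> r'; rewrite /upd; case: eqP => //; lia.
  rewrite /upd !eqxx; case: eqP => [rd|_]; last by rewrite add0n; case: sm => ->.
  by move: lt_r; rewrite rd /var_bound ltnNge gt_d.
- move=> /andP[wf1 wf2] sm; rewrite !exec_seq_cat.
  have [m1 [-> A1 V1]] := IH1 d a m gt_d wf1 sm.
  have sm1 := agree_sim gt_d A1 sm.
  have [m2 [-> A2 V2]] := IH2 d.+1 (a + size (compile_expr e1 d)) m1 (ltnW gt_d) wf2 sm1.
  rewrite !size_cat /= !addnA !(addnS, addn0); eexists; split; first reflexivity.
    have := wf_expr_lt wf2 => lt_d r lt_r; rewrite /upd; case: eqP => [|_]; first lia.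
    by apply: (agree_trans (leqnSn d) A1 A2).
  by rewrite /upd eqxx V2 A2 ?V1 // leqnn.
- move=> /andP[wf1 wf2] sm; rewrite !exec_seq_cat.
  have [m1 [-> A1 V1]] := IH1 d a m gt_d wf1 sm.
  have sm1 := agree_sim gt_d A1 sm.
  have [m2 [-> A2 V2]] := IH2 d.+1 (a + size (compile_expr e1 d)) m1 (ltnW gt_d) wf2 sm1.
  rewrite !size_cat /= !addnA !(addnS, addn0); eexists; split; first reflexivity.
    have := wf_expr_lt wf2 => lt_d r lt_r; rewrite /upd; case: eqP => [|_]; first lia.
    by apply: (agree_trans (leqnSn d) A1 A2).
  by rewrite /upd eqxx V2 A2 ?V1 // leqnn.
- move=> /and3P[lt_t lt_d wf_e] sm; rewrite 2!exec_seq_cat.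
  have [m1 [-> A1 V1]] := IH d a m gt_d wf_e sm.
  have [m2 [-> V2 A2]] :=
    @exec_address t d d.+1 (a + size (compile_expr e d)) m1 w
      (negbT (ltn_eqF (ltnSn d))).
  rewrite !size_cat !addnA /= !(addnS, addn0); eexists; split; first reflexivity.
    move=> r lt_r; rewrite /upd; case: eqP => [|rd]; first lia.
    by rewrite A2 ?A1 //; lia.
  have sm1 := agree_sim gt_d A1 sm.
  rewrite /upd eqxx V2 A2 ?V1; try lia.
  by case: sm1 => _ ->.
Qed.

Definition scratch := 16.

Definition jump (l : nat) : seq instr := [:: Const scratch 1; JumpPos scratch l].

(** Jump targets are absolute, hence the address [a]. The only jump is taken on a positive value:
    the else branch therefore follows the test directly, and a loop test jumps over the two
    instructions of the exit jump. *)
Fixpoint compile (a : nat) (c : cmd) : seq instr :=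
  match c with
  | Assign r e =>
      compile_expr e scratch ++ [:: Const 17 0; Add r scratch 17]
  | Store t e1 e2 =>
      ((compile_expr e1 scratch ++ compile_expr e2 17) ++
       address t scratch 18) ++ [:: StoreInd scratch 17]
  | Input r => [:: Read r]
  | Seq c1 c2 => let s1 := compile a c1 in s1 ++ compile (a + size s1) c2
  | If e c1 c2 =>
      let s := compile_expr e scratch in
      let s2 := compile (a + size s + 1) c2 in
      let b := a + size s + 1 + size s2 + 2 in
      let s1 := compile b c1 in
      ((s ++ [:: JumpPos scratch b]) ++ s2 ++ jump (b + size s1)) ++ s1
  | While e c =>
      let s := compile_expr e scratch in
      let b := a + size s + 3 in
      let s1 := compile b c in
      ((s ++ [:: JumpPos scratch b]) ++ jump (b + size s1 + 2)) ++ s1 ++ jump a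
  end.

Fixpoint wf (c : cmd) : bool :=
  match c with
  | Assign r e => (r < var_bound) && wf_expr e scratch
  | Store t e1 e2 => [&& t < array_bound, wf_expr e1 scratch & wf_expr e2 17]
  | Input r => r < var_bound
  | Seq c1 c2 => wf c1 && wf c2
  | If e c1 c2 => [&& wf_expr e scratch, wf c1 & wf c2]
  | While e c => wf_expr e scratch && wf c
  end.

(** Quantifying over every program that contains the code makes the statement compositional.
    Well-formedness is a premise, so that it is checked only once, by computation on the complete
    program. *)
Definition runs (c : cmd) (s : store) (n : nat) (s' : store) : Prop :=
  wf c -> forall P a m, code_at P a (compile a c) -> sim s m ->
  exists2 m', sim s' m' &
    reaches P n (State a m (inp s)) (State (a + size (compile a c)) m' (inp s')).

Lemma runs_leq c s n n' s' : n <= n' -> runs c s n s' -> runs c s n' s'.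
Proof.
move=> le_n Rc wfc P a m Pa sm; have [m' sm' R] := Rc wfc P a m Pa sm.
by exists m' => //; apply: reaches_leq R.
Qed.

Definition expr_cost (e : expr) : nat := size (compile_expr e scratch).

(** [expr_cost] measures code for register 16, but [Store] compiles its second operand for register
    17. *)
Lemma size_compile_expr e d d' : size (compile_expr e d) = size (compile_expr e d').
Proof.
by elim: e d d' => //= [e1 I1 e2 I2|e1 I1 e2 I2|t e I] d d';
  rewrite !size_cat /= ?(I1 d d') ?(I2 d.+1 d'.+1) ?(I d d').
Qed.

Lemma runs_assign r e s :
  runs (Assign r e) s (expr_cost e + 2) (set_sc s r (eval s e)).
Proof.
move=> /= /andP[lt_r wfe] P a m Pa sm.
have [m1 [E1 A1 V1]] := exec_expr a (inp s) (isT : 15 < scratch) wfe sm.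
have := @reaches_exec_seq P _ (State a m (inp s)) _ Pa.
rewrite all_cat straight_expr exec_seq_cat E1 => /(_ isT).
rewrite !size_cat -/(expr_cost e) /= => R.
have ? : r < 16 by [].
have sm1 := agree_sim (isT : 15 < scratch) A1 sm.
eexists; last by move: R; rewrite !addnA !(addnS, addn0); apply.
case: sm1 => simv sima; split=> [r' lt_r'|t i lt_t]; rewrite /upd /=.
  have ? : r' < 16 by [].
  rewrite /upd; case: eqP => _; first by rewrite ?addn0 V1.
  by case: eqP => [|_]; [lia|exact: simv].
case: eqP => [|_]; first lia.
by case: eqP => [|_]; [lia|exact: sima].
Qed.

Lemma runs_store t e1 e2 s :
  runs (Store t e1 e2) s (expr_cost e1 + (expr_cost e2 + 8))
    (set_ar s t (eval s e1) (eval s e2)).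
Proof.
move=> /= /and3P[lt_t wf1 wf2] P a m Pa sm.
have [m1 [E1 A1 V1]] := exec_expr a (inp s) (isT : 15 < scratch) wf1 sm.
have sm1 := agree_sim (isT : 15 < scratch) A1 sm.
have [m2 [E2 A2 V2]] :=
  exec_expr (a + size (compile_expr e1 16)) (inp s) (isT : 15 < 17) wf2 sm1.
have sm2 := agree_sim (isT : 15 < 17) A2 sm1.
have [m3 [E3 V3 A3]] := @exec_address t 16 18
  (a + size (compile_expr e1 16) + size (compile_expr e2 17)) m2 (inp s) isT.
have := @reaches_exec_seq P _ (State a m (inp s)) _ Pa.
rewrite !all_cat !straight_expr 3!exec_seq_cat E1 E2 E3 => /(_ isT).
rewrite !size_cat /expr_cost (@size_compile_expr e2 scratch 17) /=.
rewrite -/(expr_cost e1) => R.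
have ? : t < 32 by [].
eexists; last by move: R; rewrite !addnA !(addnS, addn0); apply.
rewrite (A3 17) // V2 V3 A2 // V1.
case: sm2 => simv sima; split=> [r' lt_r'|t' i lt_t']; rewrite /upd /=.
  have ? : r' < 16 by [].
  by case: eqP => [|_]; [lia|rewrite A3 ?simv //; lia].
have ? : t' < 32 by [].
case: eqP => [eq_addr|ne_addr].
  have [-> ->] : t' = t /\ i = eval s e1 by lia.
  by rewrite !eqxx.
case: andP => [[/eqP eq_t /eqP eq_i]|_]; first by rewrite eq_t eq_i in ne_addr.
by rewrite A3 ?sima //; lia.
Qed.

Lemma runs_input r s :
  runs (Input r) s 1 (Sto (upd (sc s) r (head 0 (inp s))) (ar s) (behead (inp s))).
Proof.
move=> /= lt_r P a m [Pa _] [simv sima].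
have ? : r < 16 by [].
rewrite addn1; eexists; last by eapply reaches_step; [exact: Pa | reflexivity].
split=> [r' lt_r'|t i lt_t] /=; rewrite /upd; case: eqP => // ?;
  [exact: simv|lia|exact: sima].
Qed.

Lemma runs_seq c1 c2 s1 s2 s3 n1 n2 :
  runs c1 s1 n1 s2 -> runs c2 s2 n2 s3 -> runs (Seq c1 c2) s1 (n1 + n2) s3.
Proof.
move=> R1 R2 /= /andP[wf1 wf2] P a m /code_at_cat[P1 P2] sm1.
have [m2 sm2 r1] := R1 wf1 P a m P1 sm1.
have [m3 sm3 r2] := R2 wf2 P _ m2 P2 sm2.
by exists m3 => //; rewrite size_cat addnA; apply: reaches_trans r2.
Qed.

Lemma reaches_guard P e l s a m :
    wf_expr e scratch -> code_at P a (compile_expr e scratch ++ [:: JumpPos scratch l]) ->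
    sim s m ->
  exists2 m', sim s m' &
    reaches P (expr_cost e + 1) (State a m (inp s))
      (State (if 0 < eval s e then l else a + expr_cost e + 1) m' (inp s)).
Proof.
move=> wfe /code_at_cat[P1 P2] sm.
have [m1 [E1 A1 V1]] := exec_expr a (inp s) (isT : 15 < scratch) wfe sm.
exists m1; first exact: agree_sim A1 sm.
have := @reaches_exec_seq P _ (State a m (inp s)) (straight_expr _ _) P1.
rewrite E1 => R; apply: reaches_trans R _; case: P2 => P2 _.
by eapply reaches_step; [exact: P2|]; rewrite /= V1 addn1.
Qed.

Lemma reaches_jump P l s a m :
    code_at P a (jump l) -> sim s m ->
  exists2 m', sim s m' & reaches P 2 (State a m (inp s)) (State l m' (inp s)).
Proof.
move=> [P1 [P2 _]] sm; exists (upd m scratch 1).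
  apply: (@agree_sim _ scratch) sm => // r lt_r.
  by rewrite /upd; case: eqP lt_r => // ->.
apply: (@reaches_trans _ 1 1); first by eapply reaches_step; [exact: P1 | reflexivity].
by eapply reaches_step; [exact: P2|].
Qed.

Lemma reaches_pc P n st a a' m w :
  a = a' -> reaches P n st (State a m w) -> reaches P n st (State a' m w).
Proof. by move->. Qed.

Lemma code_at_pc P a a' s : a = a' -> code_at P a s -> code_at P a' s.
Proof. by move->. Qed.

Lemma runs_if e c1 c2 s s' n :
    runs (if 0 < eval s e then c1 else c2) s n s' ->
  runs (If e c1 c2) s (expr_cost e + 1 + n + 2) s'.
Proof.
move=> R /= /and3P[wfe wf1 wf2] P a m /= /code_at_cat[/code_at_cat[Pe]].
set s2 := compile _ c2; set b := _ + 2 => /code_at_cat[P2 Pj] P1 sm.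
have {}P1 : code_at P b (compile b c1).
  by apply: code_at_pc P1; rewrite /b !size_cat /=; lia.
have {}P2 : code_at P (a + expr_cost e + 1) s2.
  by apply: code_at_pc P2; rewrite /expr_cost size_cat /=; lia.
have [m1 sm1 r1] := reaches_guard wfe Pe sm.
case: ifP R r1 => _ R r1.
  have [m2 sm2 r2] := R wf1 P _ m1 P1 sm1.
  exists m2 => //; apply: reaches_leq (leq_addr 2 _) _.
  apply: reaches_trans r1 _; apply: reaches_pc r2.
  by rewrite !size_cat /= /b; lia.
have [m2 sm2 r2] := R wf2 P _ m1 P2 sm1.
have {}Pj : code_at P (a + expr_cost e + 1 + size s2) (jump (b + size (compile b c1))).
  by apply: code_at_pc Pj; rewrite size_cat /= /expr_cost; lia.
have [m3 sm3 r3] := reaches_jump Pj sm2.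
exists m3 => //; apply: reaches_trans (reaches_trans r1 r2) _; apply: reaches_pc r3.
by rewrite !size_cat /= /b; lia.
Qed.

Lemma runs_while_false e c s :
  eval s e = 0 -> runs (While e c) s (expr_cost e + 3) s.
Proof.
move=> e0 /= /andP[wfe wfc] P a m /= /code_at_cat[/code_at_cat[Pe]].
set b := a + _ + 3 => Pj _ sm.
have [m1 sm1 r1] := reaches_guard wfe Pe sm.
rewrite e0 /= in r1.
have {}Pj : code_at P (a + expr_cost e + 1) (jump (b + size (compile b c) + 2)).
  by apply: code_at_pc Pj; rewrite /expr_cost size_cat /=; lia.
have [m2 sm2 r2] := reaches_jump Pj sm1.
exists m2 => //; rewrite (addnA _ 1 2); apply: reaches_trans r1 (reaches_pc _ r2).
by rewrite !size_cat /= /b; lia.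
Qed.

Lemma runs_while_true e c s s' s'' n n' :
    0 < eval s e -> runs c s n s' -> runs (While e c) s' n' s'' ->
  runs (While e c) s (expr_cost e + 3 + n + n') s''.
Proof.
move=> e_gt0 Rc Rw wfw P a m Pw sm.
have [wfe wfc] := andP wfw.
move: (Pw) => /= /code_at_cat[/code_at_cat[Pe _]].
set b := a + _ + 3 => /code_at_cat[Pc Pj].
have [m1 sm1 r1] := reaches_guard wfe Pe sm.
rewrite e_gt0 -/b in r1.
have {}Pc : code_at P b (compile b c).
  by apply: code_at_pc Pc; rewrite /b !size_cat /=; lia.
have [m2 sm2 r2] := Rc wfc P _ m1 Pc sm1.
have {}Pj : code_at P (b + size (compile b c)) (jump a).
  by apply: code_at_pc Pj; rewrite /b !size_cat /=; lia.
have [m3 sm3 r3] := reaches_jump Pj sm2.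
have [m4 sm4 r4] := Rw wfw P a m3 Pw sm3.
exists m4 => //.
apply: reaches_leq (reaches_trans r1 (reaches_trans r2 (reaches_trans r3 r4))).
by lia.
Qed.

(** * Static cost of loop-free commands *)

Fixpoint loop_free (c : cmd) : bool :=
  match c with
  | Seq c1 c2 | If _ c1 c2 => loop_free c1 && loop_free c2
  | While _ _ => false
  | _ => true
  end.

Fixpoint denote (c : cmd) (s : store) : store :=
  match c with
  | Assign r e => set_sc s r (eval s e)
  | Store t e1 e2 => set_ar s t (eval s e1) (eval s e2)
  | Input r => Sto (upd (sc s) r (head 0 (inp s))) (ar s) (behead (inp s))
  | Seq c1 c2 => denote c2 (denote c1 s)
  | If e c1 c2 => if 0 < eval s e then denote c1 s else denote c2 s
  | While _ _ => s
  end.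

(** [If] is charged for both branches, which keeps the bound independent of the store; loops are
    charged separately, through their number of turns. *)
Fixpoint cost (c : cmd) : nat :=
  match c with
  | Assign _ e => expr_cost e + 2
  | Store _ e1 e2 => expr_cost e1 + (expr_cost e2 + 8)
  | Input _ => 1
  | Seq c1 c2 => cost c1 + cost c2
  | If e c1 c2 => expr_cost e + 1 + (cost c1 + cost c2) + 2
  | While _ _ => 0
  end.

Lemma runs_denote c s : loop_free c -> runs c s (cost c) (denote c s).
Proof.
elim: c s => //=; [move=> r e|move=> t e1 e2|move=> r|move=> c1 I1 c2 I2|
  move=> e c1 I1 c2 I2] => s.
- by move=> _; exact: runs_assign.
- by move=> _; exact: runs_store.
- by move=> _; exact: runs_input.
- by move=> /andP[l1 l2]; apply: runs_seq; [exact: I1|exact: I2].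
- move=> /andP[l1 l2]; apply: runs_if; case: ifP => _.
    by apply: runs_leq (I1 s l1); exact: leq_addr.
  by apply: runs_leq (I2 s l2); exact: leq_addl.
Qed.

Definition decider (c : cmd) (r : nat) : program :=
  let s := compile 0 c in
  s ++ [:: JumpPos r (size s + 2); Reject; Accept].

Lemma run_decider c r w s n :
    wf c -> r < var_bound ->
    runs c (Sto (fun=> 0) (fun _ _ => 0) w) n s ->
  run (decider c r) (n + 2) (start w) = Some (0 < sc s r).
Proof.
move=> wfc lt_r Rc.
have P1 : code_at (decider c r) 0 (compile 0 c).
  by have /code_at_cat[] := code_at_suffix [::] (decider c r).
have P2 := code_at_suffix (compile 0 c)
  [:: JumpPos r (size (compile 0 c) + 2); Reject; Accept].
have [|m [simv _] [n' le_n R]] := Rc wfc _ 0 (fun=> 0) P1; first by split.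
(* The two extra steps are the test of the answer and the halting instruction. *)
apply: (@run_leq _ (n' + 2)); first by rewrite leq_add2r.
rewrite R /=; case: P2 => -> [Pr [Pa _]]; rewrite /= simv //.
by case: ifP => _; rewrite ?addn2 ?add0n ?Pr ?Pa.
Qed.

(** * Configurations and their depth-first search *)

Section MixedRadix.
Variable n : nat -> nat.

Definition stride (j : nat) : nat := \prod_(h < j) (n h).+1.

Lemma strideS j : stride j.+1 = stride j * (n j).+1.
Proof. exact: big_ord_recr. Qed.

Lemma stride_gt0 j : 0 < stride j.
Proof. by rewrite prodn_gt0. Qed.

Definition radix (c : nat -> nat) (k : nat) : nat := \sum_(i < k) c i * stride i.

Lemma radixS c k : radix c k.+1 = radix c k + c k * stride k.
Proof. exact: big_ord_recr. Qed.

Lemma radix_lt c k : (forall i, i < k -> c i <= n i) -> radix c k < stride k.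
Proof.
elim: k => [|k IHk] le_c; first by rewrite /radix big_ord0 stride_gt0.
rewrite radixS strideS; have := IHk (fun i lt_i => le_c i (ltnW lt_i)).
by have := le_c k (ltnSn k); nia.
Qed.

(** Maximal digits give the last index, so the machine can recognise the final configuration from
    its index alone, without comparing [k] entries. *)
Lemma radix_max k : (radix n k).+1 = stride k.
Proof.
elim: k => [|k IHk]; first by rewrite /radix /stride !big_ord0.
by rewrite radixS strideS -IHk; nia.
Qed.

Lemma radix_inj c c' k :
    (forall i, i < k -> c i <= n i) -> (forall i, i < k -> c' i <= n i) ->
    radix c k = radix c' k ->
  forall i, i < k -> c i = c' i.
Proof.
elim: k => // k IHk le_c le_c'; rewrite !radixS => eq_r.
have lt_r := radix_lt (fun i lt_i => le_c i (ltnW lt_i)).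
have lt_r' := radix_lt (fun i lt_i => le_c' i (ltnW lt_i)).
(* The lower digits sum to less than the top weight, so division by this weight isolates the top
   digit. *)
have eq_k : c k = c' k.
  have := congr1 (divn^~ (stride k)) eq_r.
  by rewrite !divnDMl ?stride_gt0 // !divn_small.
have eq_k' : radix c k = radix c' k by rewrite eq_k in eq_r; apply: addIn eq_r.
move=> i; rewrite ltnS leq_eqVlt => /predU1P[->//|].
by apply: IHk => // l lt_l; [apply: le_c|apply: le_c']; apply: ltnW.
Qed.

End MixedRadix.

Section Search.
Variable I : instance.
Local Notation k := (nseqs I).
Local Notation config := (configuration I).

Definition symbols : seq (seq nat) :=
  [seq [seq plt b | b <- q] | q : seq (bin I) <- seqs I].
Definition len (j : nat) : nat := size (nth [::] symbols j).

Lemma nth_symbols (j : 'I_k) : nth [::] symbols j = [seq plt b | b <- sq j].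
Proof. by rewrite (nth_map [::]) ?size_tuple // /sq (tnth_nth [::]). Qed.

Lemma len_sq (j : 'I_k) : len j = size (sq j).
Proof. by rewrite /len nth_symbols size_map. Qed.

Lemma size_symbols : size symbols = k.
Proof. by rewrite size_map size_tuple. Qed.

Definition inc (c : config) (j : 'I_k) : config :=
  [ffun l => if l == j then (c l).+1 else c l].

Definition bounded (c : config) : bool := [forall j, c j <= len j].

Definition index_of (c : config) : nat := \sum_j c j * stride len j.

(** Extends a configuration to all of [nat], since the radix lemmas are proved by induction on the
    number of digits. *)
Definition lookup (c : config) (i : nat) : nat := oapp c 0 (insub i).

Lemma lookup_ord (c : config) (j : 'I_k) : lookup c j = c j.
Proof. by rewrite /lookup valK. Qed.

Lemma index_ofE c : index_of c = radix len (lookup c) k.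
Proof. by apply: eq_bigr => j _; rewrite lookup_ord. Qed.

Lemma bounded_lookup c : bounded c -> forall i, i < k -> lookup c i <= len i.
Proof.
by move=> /forallP b_c i lt_i; rewrite -[i]/(nat_of_ord (Ordinal lt_i)) lookup_ord.
Qed.

Lemma index_of_lt c : bounded c -> index_of c < stride len k.
Proof. by move=> b_c; rewrite index_ofE; apply/radix_lt/bounded_lookup. Qed.

Lemma index_of_inj : {in bounded &, injective index_of}.
Proof.
move=> c c' b_c b_c'; rewrite !index_ofE => eq_i; apply/ffunP => j.
rewrite -!lookup_ord.
by apply: (radix_inj _ _ eq_i) => //; apply: bounded_lookup.
Qed.

Lemma bounded_initial : bounded (initial I).
Proof. by apply/forallP => j; rewrite ffunE. Qed.

Lemma bounded_final : bounded (final I).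
Proof. by apply/forallP => j; rewrite ffunE len_sq. Qed.

Lemma index_of_final : (index_of (final I)).+1 = stride len k.
Proof.
rewrite -radix_max /index_of; congr _.+1.
by apply: eq_bigr => j _; rewrite ffunE len_sq.
Qed.

Lemma index_of_initial : index_of (initial I) = 0.
Proof. by apply: big1 => j _; rewrite ffunE. Qed.

Lemma incE c j : inc c j j = (c j).+1.
Proof. by rewrite ffunE eqxx. Qed.

Lemma inc_neq c j l : l != j -> inc c j l = c l.
Proof. by move=> /negbTE ne_l; rewrite ffunE ne_l. Qed.

Lemma index_of_inc c j : index_of (inc c j) = index_of c + stride len j.
Proof.
rewrite /index_of (bigD1 j) // [in RHS](bigD1 j) //= incE mulSn.
by under eq_bigr => l ne_l do rewrite inc_neq //; lia.
Qed.

Lemma bounded_inc (c : config) (j : 'I_k) : bounded c -> c j < len j -> bounded (inc c j).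
Proof.
by move=> /forallP b_c lt_j; apply/forallP => l; rewrite ffunE; case: eqP => // ->.
Qed.

(** * Open pallets through counters of removed bins *)

Definition removed (c : config) (t : nat) : nat :=
  \sum_j count_mem t (take (c j) (nth [::] symbols j)).

Definition total (t : nat) : nat := count_mem t (flatten symbols).

Lemma totalE t : total t = \sum_(j < k) count_mem t (nth [::] symbols j).
Proof.
rewrite /total count_flatten sumnE big_map (big_nth [::]) size_symbols.
exact: big_mkord.
Qed.

Lemma total_removed c t :
  total t = removed c t + \sum_j count_mem t (drop (c j) (nth [::] symbols j)).
Proof.
rewrite totalE -big_split; apply: eq_bigr => j _ /=.
by rewrite -count_cat cat_take_drop.
Qed.

Lemma sum_count_gt0 t (f : 'I_k -> seq nat) :
  (0 < \sum_j count_mem t (f j)) = [exists j, t \in f j].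
Proof.
rewrite lt0n sum_nat_eq0 negb_forall; apply: eq_existsb => j.
by rewrite implyTb -lt0n -has_count has_pred1.
Qed.

(** Cutting every sequence at its position splits the bins of [t] into removed and remaining ones,
    so the status of a pallet depends on two counters only. *)
Lemma is_openE c t : is_open c t = (0 < removed c t < total t).
Proof.
have -> : (removed c t < total t) =
    [exists j : 'I_k, t \in drop (c j) (nth [::] symbols j)].
  by rewrite (total_removed c) -[X in X < _]addn0 ltn_add2l sum_count_gt0.
rewrite /removed sum_count_gt0 /is_open.
apply/existsP/andP => [[j /existsP[l /andP[tj tl]]]|[/existsP[j tj] /existsP[l tl]]].
  split; apply/existsP; [exists j|exists l]; rewrite nth_symbols -?map_take -?map_drop //.
exists j; apply/existsP; exists l; rewrite map_take map_drop.
by rewrite -!nth_symbols tj tl.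
Qed.

Definition next (c : config) (j : 'I_k) : nat := nth 0 (nth [::] symbols j) (c j).

Lemma removed_inc (c : config) (j : 'I_k) t :
  c j < len j -> removed (inc c j) t = removed c t + (t == next c j).
Proof.
move=> lt_j; rewrite /removed (bigD1 j) // [in RHS](bigD1 j) //= incE.
rewrite (take_nth 0) // -cats1 count_cat /= addn0 eq_sym.
by under eq_bigr => l ne_l do rewrite inc_neq //; rewrite -/(next c j); lia.
Qed.

Lemma removed_lt (c : config) (j : 'I_k) :
  c j < len j -> removed c (next c j) < total (next c j).
Proof.
move=> lt_j; rewrite (total_removed c) -[X in X < _]addn0 ltn_add2l sum_count_gt0.
by apply/existsP; exists j; rewrite (drop_nth 0) // inE eqxx.
Qed.

Lemma next_pallets (c : config) (j : 'I_k) : c j < len j -> next c j \in pallets I.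
Proof.
move=> lt_j; rewrite mem_undup map_flatten; apply/flattenP.
exists (nth [::] symbols j); last exact: mem_nth.
by apply: mem_nth; rewrite size_symbols.
Qed.

Lemma removed_initial t : removed (initial I) t = 0.
Proof. by apply: big1 => j _; rewrite ffunE take0. Qed.

Lemma num_open_initial : num_open (initial I) = 0.
Proof.
apply/eqP; rewrite -leqn0 leqNgt -has_count; apply/hasP => -[t _].
by rewrite is_openE removed_initial.
Qed.

(** A pallet opens when its first bin is removed and closes when its last one
    is; both differences are 0 or 1 by truncation. *)
Lemma num_open_inc (c : config) (j : 'I_k) : c j < len j ->
  let t := next c j in
  num_open (inc c j)
    = num_open c + (1 - removed c t) - (1 - (total t - removed c t - 1)).
Proof.
move=> lt_j t; have t_in := next_pallets lt_j; rewrite -/t in t_in.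
(* Isolates the contribution of [t]: no other pallet changes its status. *)
have numE (c' : config) :
    num_open c' = is_open c' t + count (is_open c') (rem t (pallets I)).
  exact: (permP (perm_to_rem t_in) (is_open c')).
rewrite !numE.
have -> : count (is_open (inc c j)) (rem t (pallets I)) =
    count (is_open c) (rem t (pallets I)).
  apply: eq_in_count => u; rewrite mem_rem_uniq ?undup_uniq // => /andP[/negbTE ne_u _].
  by rewrite !is_openE removed_inc // ne_u addn0.
rewrite !is_openE removed_inc // eqxx; have := removed_lt lt_j; rewrite -/t.
by lia.
Qed.

Definition good (c : config) : bool := num_open c <= places I.

Definition good_reach (c : config) : Prop :=
  exists s, [/\ path (@transformation_step I) (initial I) s,
                last (initial I) s = c & all good (initial I :: s)].

Lemma stepP (c c' : config) :
  reflect (exists2 j : 'I_k, c j < len j & c' = inc c j) (transformation_step c c').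
Proof.
apply: (iffP existsP) => [[j /andP[lt_j /eqP->]]|[j lt_j ->]]; exists j => //.
  by rewrite len_sq.
by rewrite -len_sq lt_j /=.
Qed.

Lemma good_reach_initial : good_reach (initial I).
Proof. by exists [::]; split=> //=; rewrite /good num_open_initial. Qed.

Lemma good_reach_inc (c : config) (j : 'I_k) :
  good_reach c -> c j < len j -> good (inc c j) -> good_reach (inc c j).
Proof.
move=> [s [ps <- gs]] lt_j g_i; exists (rcons s (inc (last (initial I) s) j)).
rewrite last_rcons rcons_path ps -rcons_cons all_rcons gs g_i; split=> //=.
by apply/stepP; exists j.
Qed.

Lemma good_reach_final : good_reach (final I) <-> has_processing I.
Proof.
split=> [[s [ps ls gs]]|[s [/andP[ps /eqP ls] gs]]]; last by exists s.
by exists s; split=> //; rewrite /is_processing ps ls /=.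
Qed.

(** A frame [(c, j)] stands for a configuration whose successor along [j] is
    being explored. *)
Definition frame := (config * 'I_k)%type.

(** The machine stores no configuration in a frame; this relation lets a pop recover it by undoing a
    single removal. *)
Fixpoint chain (c : config) (stk : seq frame) : Prop :=
  if stk is (c', j) :: stk' then
    [/\ c = inc c' j, c' j < len j & chain c' stk']
  else c = initial I.

(** An edge has been followed, or is still ahead in the current configuration, or waits in a
    suspended frame, strictly after the edge being explored there. Only good configurations are
    concerned: bad ones are marked as visited but never expanded. *)
Definition explored (c : config) (j : nat) (stk : seq frame) (vis : seq config) :=
  forall v l, v \in vis -> good v -> v l < len l ->
    [\/ inc v l \in vis, v = c /\ j <= l |
        exists2 l' : 'I_k, (v, l') \in stk & l' < l].

(** [inv_reach] justifies acceptance; [inv_initial], [inv_explored] and [inv_final] justify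
    rejection. The last one holds because the search never moves on from the final configuration. *)
Record search_inv (c : config) (j : nat) (stk : seq frame) (vis : seq config) : Prop :=
  SearchInv {
    inv_reach : good_reach c;
    inv_bounded_cur : bounded c;
    inv_frames : forall f, f \in stk -> good_reach f.1 /\ bounded f.1;
    inv_chain : chain c stk;
    inv_uniq : uniq vis;
    inv_bounded : all bounded vis;
    inv_initial : initial I \in vis;
    inv_explored : explored c j stk vis;
    inv_final : final I \in vis -> good (final I) -> c = final I
  }.

Lemma search_inv_initial : search_inv (initial I) 0 [::] [:: initial I].
Proof.
split=> //; rewrite ?mem_seq1 //; first exact: good_reach_initial.
- exact: bounded_initial.
- by rewrite /= bounded_initial.
- by move=> v l; rewrite mem_seq1 => /eqP-> _ _; apply: Or32.
- by move=> /eqP.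
Qed.

Lemma search_inv_size c j stk vis : search_inv c j stk vis -> size vis <= stride len k.
Proof.
case=> _ _ _ _ u_vis /allP b_vis _ _ _.
rewrite -(size_map index_of) -(size_iota 0 (stride len k)); apply: uniq_leq_size.
  by rewrite map_inj_in_uniq // => x y /b_vis b_x /b_vis b_y; apply: index_of_inj.
by move=> _ /mapP[x /b_vis b_x ->]; rewrite mem_iota index_of_lt.
Qed.

Lemma search_inv_skip c (j : 'I_k) stk vis :
    search_inv c j stk vis -> (c j < len j -> inc c j \in vis) ->
  search_inv c j.+1 stk vis.
Proof.
case=> ? ? ? ? ? ? ? expl ? seen; split=> // v l v_vis g_v lt_l.
case: (expl v l v_vis g_v lt_l) => [||]; [exact: Or31| |exact: Or33].
case=> eq_v; rewrite leq_eqVlt => /predU1P[eq_l|lt_jl]; last by apply: Or32.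
by apply: Or31; rewrite eq_v -(val_inj eq_l) seen // (val_inj eq_l) -eq_v.
Qed.

Lemma search_inv_bad c (j : 'I_k) stk vis :
    search_inv c j stk vis -> c j < len j -> inc c j \notin vis ->
    ~~ good (inc c j) ->
  search_inv c j.+1 stk (inc c j :: vis).
Proof.
move=> inv lt_j new bad; apply: search_inv_skip; last by rewrite inE eqxx.
case: inv => ? b_c ? ? u_vis b_vis in0 expl fin; split=> //=.
- by rewrite new.
- by rewrite bounded_inc.
- by rewrite inE in0 orbT.
- move=> v l; rewrite inE => /predU1P[->|v_vis] g_v lt_l; first by rewrite g_v in bad.
  case: (expl v l v_vis g_v lt_l) => [in_v||]; [|exact: Or32|exact: Or33].
  by apply: Or31; rewrite inE in_v orbT.
- rewrite inE => /predU1P[eq_f|]; last exact: fin.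
  by rewrite eq_f (negbTE bad).
Qed.

Lemma search_inv_push c (j : 'I_k) stk vis :
    search_inv c j stk vis -> c != final I -> c j < len j -> inc c j \notin vis ->
    good (inc c j) ->
  search_inv (inc c j) 0 ((c, j) :: stk) (inc c j :: vis).
Proof.
move=> [r_c b_c fr ch u_vis b_vis in0 expl fin] ne_c lt_j new g_i; split=> //=.
- exact: good_reach_inc.
- exact: bounded_inc.
- by move=> f; rewrite inE => /predU1P[->|/fr].
- by rewrite new.
- by rewrite bounded_inc.
- by rewrite inE in0 orbT.
- move=> v l; rewrite inE => /predU1P[->|v_vis] g_v lt_l; first exact: Or32.
  case: (expl v l v_vis g_v lt_l) => [in_v|[eq_v]|[l' in_v lt_l']].
  + by apply: Or31; rewrite inE in_v orbT.
  (* Of the pending edges of [c], edge [j] now leads to a visited configuration, and the later ones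
     wait in the new frame. *)
  + rewrite leq_eqVlt => /predU1P[eq_l|lt_jl].
      by apply: Or31; rewrite inE eq_v (val_inj eq_l) eqxx.
    by apply: Or33; exists j; rewrite // inE eq_v eqxx.
  + by apply: Or33; exists l'; rewrite // inE in_v orbT.
- rewrite inE => /predU1P[->//|/fin H] /H eq_c.
  by rewrite eq_c eqxx in ne_c.
Qed.

(** At position [k] the configuration [c] has no edge left, and the edges beyond [j] that waited in
    the popped frame become the pending edges of [c']. *)
Lemma search_inv_pop c c' (j : 'I_k) stk vis :
    search_inv c k ((c', j) :: stk) vis -> c != final I ->
  search_inv c' j.+1 stk vis.
Proof.
move=> [r_c b_c fr ch u_vis b_vis in0 expl fin] ne_c.
have [r_c' b_c'] := fr _ (mem_head _ _); case: ch => eq_c lt_j ch.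
split=> //.
- by move=> f f_stk; apply: fr; rewrite inE f_stk orbT.
- move=> v l v_vis g_v lt_l.
  case: (expl v l v_vis g_v lt_l) => [in_v|[_]|[l' in_v lt_l']]; first exact: Or31.
    by rewrite leqNgt ltn_ord.
  move: in_v; rewrite inE => /predU1P[[eq_v eq_l]|in_v].
    by apply: Or32; rewrite -eq_l.
  by apply: Or33; exists l'.
- by move=> /fin H /H eq_f; rewrite eq_f eqxx in ne_c.
Qed.

(** With an empty stack and no pending edge, [explored] says that [vis] is closed under steps out of
    good configurations; it then contains the end of every good processing, against [inv_final]. *)
Lemma search_inv_reject c vis :
  search_inv c k [::] vis -> c != final I -> ~ has_processing I.
Proof.
move=> [r_c b_c fr ch u_vis b_vis in0 expl fin] ne_c /good_reach_final[s [ps ls gs]].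
suff f_vis : final I \in vis.
  move: ne_c; rewrite (fin f_vis) ?eqxx // -ls.
  by apply: (allP gs); exact: mem_last.
(* The induction needs an arbitrary visited starting point in place of [initial I]. *)
rewrite -ls; elim: s (initial I) in0 ps gs {ls} => //= v' s IHs v v_vis.
move=> /andP[/stepP[j lt_j eq_v'] ps] /andP[g_v gs]; apply: IHs => //.
rewrite eq_v'; case: (expl v j v_vis g_v lt_j) => // [[_]|[l]]; last by [].
by rewrite leqNgt ltn_ord.
Qed.

(** A potential for the amortised count. A push spends the [k.+1] units of an unvisited
    configuration: [k] pay for its edges and one is lost, while the share [k - j] of the suspended
    configuration moves to its frame. Skips and pops lose one unit by advancing a position. *)
Definition work (j : nat) (stk : seq frame) (vis : seq config) : nat :=
  (stride len k - size vis) * k.+1 + \sum_(f <- stk) (k - f.2) + (k - j).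

End Search.

(** * The program *)

(** [vK], [vP]: the numbers of sequences and of places; [vJ]: current sequence;
    [vN]: bins of it still to be read; [vT]: pallet symbol; [vB]: bins read;
    [vS], [vD]: strides; [vX]: index of the configuration; [vSp]: stack height;
    [vO]: open pallets; [vY], [vQ]: candidates for [vX] and [vO]. *)
Local Notation vK := 0.
Local Notation vP := 1.
Local Notation vJ := 2.
Local Notation vN := 3.
Local Notation vT := 4.
Local Notation vB := 5.
Local Notation vS := 6.
Local Notation vX := 7.
Local Notation vSp := 8.
Local Notation vO := 9.
Local Notation vGo := 10.
Local Notation vAns := 11.
Local Notation vD := 12.
Local Notation vY := 13.
Local Notation vQ := 14.

(** [aBin] lists all bins in the order of the input; [aPtr] and [aEnd] hold the
    position in it of the next bin of a sequence and of the end of the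
    sequence; [aStr]: strides; [aTot], [aRem]: bins and removed bins of a
    pallet; [aVis]: visited configurations; [aStk], [aSav]: sequence chosen and
    number of open pallets in each frame of the stack. *)
Local Notation aPtr := 0.
Local Notation aEnd := 1.
Local Notation aStr := 2.
Local Notation aBin := 3.
Local Notation aTot := 4.
Local Notation aRem := 5.
Local Notation aVis := 6.
Local Notation aStk := 7.
Local Notation aSav := 8.

Local Notation "c1 ;; c2" := (Seq c1 c2) (at level 90, right associativity).
Local Notation "r ::= e" := (Assign r e) (at level 80).
Local Notation incr r := (Assign r (Plus (Var r) (Num 1))).
Local Notation decr r := (Assign r (Minus (Var r) (Num 1))).
Local Notation incr_at a r := (Store a (Var r) (Plus (Arr a (Var r)) (Num 1))).
Local Notation decr_at a r := (Store a (Var r) (Minus (Arr a (Var r)) (Num 1))).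

Definition push : cmd :=
  Store aStk (Var vSp) (Var vJ) ;; Store aSav (Var vSp) (Var vO) ;;
  incr vSp ;; vX ::= Var vY ;; vO ::= Var vQ ;;
  incr_at aPtr vJ ;; incr_at aRem vT ;; vJ ::= Num 0.

(** Once decremented, [aPtr] points at the bin that is put back, which reveals the pallet to update.
    The open count is restored from the stack rather than recomputed. *)
Definition pop : cmd :=
  decr vSp ;; vJ ::= Arr aStk (Var vSp) ;; vO ::= Arr aSav (Var vSp) ;;
  decr_at aPtr vJ ;; vT ::= Arr aBin (Arr aPtr (Var vJ)) ;; decr_at aRem vT ;;
  vX ::= Minus (Var vX) (Arr aStr (Var vJ)) ;; incr vJ.

(** The mark in [aVis] is set before the count is tested, so a bad configuration is evaluated only
    once. *)
Definition explore : cmd :=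
  vY ::= Plus (Var vX) (Arr aStr (Var vJ)) ;;
  If (Arr aVis (Var vY)) (incr vJ)
    (Store aVis (Var vY) (Num 1) ;;
     vT ::= Arr aBin (Arr aPtr (Var vJ)) ;;
     vQ ::= Minus (Plus (Var vO) (Minus (Num 1) (Arr aRem (Var vT))))
              (Minus (Num 1)
                 (Minus (Minus (Arr aTot (Var vT)) (Arr aRem (Var vT))) (Num 1))) ;;
     If (Minus (Var vQ) (Var vP)) (incr vJ) push).

(** Truncated differences serve as strict comparisons. The first one vanishes exactly at the last
    index, that of the final configuration. *)
Definition search_step : cmd :=
  If (Minus (Minus (Var vS) (Var vX)) (Num 1))
    (If (Minus (Var vK) (Var vJ))
       (If (Minus (Arr aEnd (Var vJ)) (Arr aPtr (Var vJ))) explore (incr vJ))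
       (If (Var vSp) pop (vGo ::= Num 0)))
    (vAns ::= Num 1 ;; vGo ::= Num 0).

(** * Correspondence between the search and the memory *)

Section Machine.
Variable I : instance.
Local Notation k := (nseqs I).
Local Notation config := (configuration I).
Local Notation L := (symbols I).

Definition base (j : nat) : nat := size (flatten (take j L)).

Record static_repr (s : store) : Prop := StaticRepr {
  rp_k : sc s vK = k;
  rp_p : sc s vP = places I;
  rp_s : sc s vS = stride (len I) k;
  rp_end : forall j : 'I_k, ar s aEnd j = base j + len I j;
  rp_str : forall j : 'I_k, ar s aStr j = stride (len I) j;
  rp_bin : forall (j : 'I_k) i,
    i < len I j -> ar s aBin (base j + i) = nth 0 (nth [::] L j) i;
  rp_tot : forall t, ar s aTot t = total I t
}.

Lemma static_repr_ext s s' :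
    static_repr s ->
    sc s' vK = sc s vK -> sc s' vP = sc s vP -> sc s' vS = sc s vS ->
    ar s' aEnd = ar s aEnd -> ar s' aStr = ar s aStr -> ar s' aBin = ar s aBin ->
    ar s' aTot = ar s aTot ->
  static_repr s'.
Proof.
move=> [k_s p_s s_s end_s str_s bin_s tot_s] e1 e2 e3 e4 e5 e6 e7.
by split; rewrite ?e1 ?e2 ?e3 ?e4 ?e5 ?e6 ?e7.
Qed.

(** A frame is stored at its height above the bottom, so pushes and pops leave the lower entries in
    place. *)
Fixpoint stack_repr (s : store) (stk : seq (frame I)) : Prop :=
  if stk is (c, j) :: stk' then
    [/\ ar s aStk (size stk') = j, ar s aSav (size stk') = num_open c &
        stack_repr s stk']
  else True.

(** [rp_vis] is confined to bounded configurations because indices are injective only on them. *)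
Record repr (c : config) (j : nat) (stk : seq (frame I)) (vis : seq config)
    (s : store) : Prop := Repr {
  rp_static : static_repr s;
  rp_j : sc s vJ = j;
  rp_x : sc s vX = index_of c;
  rp_o : sc s vO = num_open c;
  rp_sp : sc s vSp = size stk;
  rp_go : sc s vGo = 1;
  rp_ans : sc s vAns = 0;
  rp_ptr : forall l : 'I_k, ar s aPtr l = base l + c l;
  rp_rem : forall t, ar s aRem t = removed c t;
  rp_vis : forall y, bounded y -> ar s aVis (index_of y) = (y \in vis);
  rp_stk : stack_repr s stk
}.

Lemma stack_repr_ext s s' stk :
    (forall i, i < size stk -> ar s' aStk i = ar s aStk i) ->
    (forall i, i < size stk -> ar s' aSav i = ar s aSav i) ->
  stack_repr s stk -> stack_repr s' stk.
Proof.
elim: stk => //= -[c j] stk IHs eq1 eq2 [<- <- sr]; split; [exact: eq1|exact: eq2|].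
by apply: IHs => // i lt_i; [apply: eq1|apply: eq2]; apply: ltnW.
Qed.

Lemma denote_seq c1 c2 s : denote (Seq c1 c2) s = denote c2 (denote c1 s).
Proof. by []. Qed.

(** Symbolic execution with a chosen form [v] of the value, which keeps the resulting store
    readable. *)
Lemma denote_assign r e s v : eval s e = v -> denote (Assign r e) s = set_sc s r v.
Proof. by move=> <-. Qed.

Lemma denote_store a e1 e2 s i v :
  eval s e1 = i -> eval s e2 = v -> denote (Store a e1 e2) s = set_ar s a i v.
Proof. by move=> <- <-. Qed.

Lemma denote_if e c1 c2 s b : (0 < eval s e) = b ->
  denote (If e c1 c2) s = if b then denote c1 s else denote c2 s.
Proof. by move=> <-. Qed.

Lemma denote_push s n j o y q t p r :
    sc s vSp = n -> sc s vJ = j -> sc s vO = o -> sc s vY = y -> sc s vQ = q ->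
    sc s vT = t -> ar s aPtr j = p -> ar s aRem t = r ->
  denote push s =
    set_sc (set_ar (set_ar (set_sc (set_sc (set_sc (set_ar (set_ar s
      aStk n j) aSav n o) vSp (n + 1)) vX y) vO q) aPtr j (p + 1)) aRem t (r + 1))
      vJ 0.
Proof.
move=> e1 e2 e3 e4 e5 e6 e7 e8; rewrite /push.
rewrite denote_seq (denote_store _ (i := n) (v := j)) //.
rewrite denote_seq (denote_store _ (i := n) (v := o)) //.
rewrite denote_seq (denote_assign _ (v := n + 1)); last by rewrite /= e1.
rewrite denote_seq (denote_assign _ (v := y)) //.
rewrite denote_seq (denote_assign _ (v := q)) //.
rewrite denote_seq (denote_store _ (i := j) (v := p + 1)) //;
  last by rewrite /= /upd /= e2 e7.
by rewrite denote_seq (denote_store _ (i := t) (v := r + 1)) //= /upd /= e6 e8.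
Qed.

Lemma denote_pop s n j o p t r x d :
    sc s vSp = n -> ar s aStk (n - 1) = j -> ar s aSav (n - 1) = o ->
    ar s aPtr j = p -> ar s aBin (p - 1) = t -> ar s aRem t = r ->
    sc s vX = x -> ar s aStr j = d ->
  denote pop s =
    set_sc (set_sc (set_ar (set_sc (set_ar (set_sc (set_sc (set_sc s
      vSp (n - 1)) vJ j) vO o) aPtr j (p - 1)) vT t) aRem t (r - 1)) vX (x - d))
      vJ (j + 1).
Proof.
move=> e1 e2 e3 e4 e5 e6 e7 e8; rewrite /pop.
rewrite denote_seq (denote_assign _ (v := n - 1)); last by rewrite /= e1.
rewrite denote_seq (denote_assign _ (v := j)) //.
rewrite denote_seq (denote_assign _ (v := o)) //.
rewrite denote_seq (denote_store _ (i := j) (v := p - 1)) //; last by rewrite /= /upd /= e4.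
rewrite denote_seq (denote_assign _ (v := t)); last by rewrite /= /upd /= eqxx.
rewrite denote_seq (denote_store _ (i := t) (v := r - 1)) //; last by rewrite /= /upd /= e6.
by rewrite denote_seq (denote_assign vX (v := x - d)) //= /upd /= e7 e8.
Qed.

Section Step.
Variables (c : config) (stk : seq (frame I)) (vis : seq config) (s : store).

(** The final configuration has the largest index, and by injectivity no other bounded one shares
    it. *)
Lemma test_final j :
    search_inv c j stk vis -> repr c j stk vis s ->
  (0 < sc s vS - sc s vX - 1) = (c != final I).
Proof.
move=> inv rp; rewrite (rp_s (rp_static rp)) (rp_x rp).
have b_c := inv_bounded_cur inv.
have lt_c := index_of_lt b_c; have max_c := index_of_final I.
apply/idP/idP => [|ne_c].
  by apply: contraTneq => eq_c; move: max_c; rewrite -eq_c; lia.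
have : index_of c != index_of (final I).
  by apply: contraNneq ne_c => /index_of_inj-> //; exact: bounded_final.
lia.
Qed.

Section Forward.
Variable j : 'I_k.
Hypotheses (inv : search_inv c j stk vis) (rp : repr c j stk vis s).
Hypothesis ne_c : c != final I.

Lemma search_step_forward :
  denote search_step s
    = if c j < len I j then denote explore s else set_sc s vJ (j + 1).
Proof.
rewrite /search_step (denote_if _ _ (b := true)); last first.
  by rewrite /= (test_final inv rp).
rewrite (denote_if _ _ (b := true)); last first.
  by rewrite /= (rp_k (rp_static rp)) (rp_j rp) subn_gt0 ltn_ord.
rewrite (denote_if _ _ (b := c j < len I j)) /= ?(rp_j rp) //.
by rewrite (rp_end (rp_static rp)) (rp_ptr rp) subnDl subn_gt0.
Qed.

Lemma repr_skip :
  c j < len I j = false -> repr c j.+1 stk vis (denote search_step s).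
Proof.
move=> nlt; rewrite search_step_forward nlt addn1.
case: rp => st *; split=> //; first by apply: (static_repr_ext st).
by apply: stack_repr_ext; last eassumption.
Qed.

Hypothesis lt_j : c j < len I j.
Let y := inc c j.
Let t := next c j.

Lemma denote_explore :
  denote explore s =
    let s1 := set_sc s vY (index_of y) in
    if y \in vis then set_sc s1 vJ (j + 1) else
    let s2 := set_sc (set_sc (set_ar s1 aVis (index_of y) 1) vT t) vQ (num_open y) in
    if good y then denote push s2 else set_sc s2 vJ (j + 1).
Proof.
have b_y : bounded y by apply: bounded_inc lt_j; exact: inv_bounded_cur inv.
rewrite /explore denote_seq (denote_assign _ (v := index_of y)); last first.
  by rewrite /= (rp_j rp) (rp_x rp) (rp_str (rp_static rp)) -index_of_inc.
rewrite (denote_if _ _ (b := y \in vis)) ?(rp_vis rp) //; last first.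
  by rewrite /= /upd /= (rp_vis rp) // lt0b.
case: ifP => _; first by rewrite (denote_assign _ (v := j + 1)) //= /upd /= (rp_j rp).
rewrite denote_seq (denote_store _ (i := index_of y) (v := 1)) //.
rewrite denote_seq (denote_assign _ (v := t)); last first.
  by rewrite /= /upd /= (rp_j rp) (rp_ptr rp) (rp_bin (rp_static rp)).
rewrite denote_seq (denote_assign _ (v := num_open y)); last first.
  rewrite /= /upd /= (rp_o rp) (rp_rem rp) (rp_tot (rp_static rp)).
  by rewrite /y num_open_inc.
rewrite (denote_if _ _ (b := ~~ good y)); last first.
  by rewrite /= /upd /= (rp_p (rp_static rp)) subn_gt0 -ltnNge.
by case: good => //=; rewrite /upd /= (rp_j rp).
Qed.

Lemma repr_seen : y \in vis -> repr c j.+1 stk vis (denote search_step s).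
Proof.
move=> in_y; rewrite search_step_forward lt_j denote_explore in_y addn1.
case: rp => st *; split=> //; first by apply: (static_repr_ext st).
by apply: stack_repr_ext; last eassumption.
Qed.

Lemma visE : y \notin vis -> forall z, bounded z ->
  (if index_of z == index_of y then 1 else ar s aVis (index_of z)) = (z \in y :: vis).
Proof.
move=> new z b_z.
have b_y : bounded y by apply: bounded_inc lt_j; exact: inv_bounded_cur inv.
rewrite inE (inj_in_eq (@index_of_inj I)) // (rp_vis rp) //.
by case: eqP.
Qed.

Lemma repr_bad :
  y \notin vis -> ~~ good y -> repr c j.+1 stk (y :: vis) (denote search_step s).
Proof.
move=> new bad.
rewrite search_step_forward lt_j denote_explore (negbTE new) (negbTE bad) addn1.
have V := visE new.
case: rp => st *; split=> //; first by apply: (static_repr_ext st).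
by apply: stack_repr_ext; last eassumption.
Qed.

Lemma repr_push :
    y \notin vis -> good y ->
  repr y 0 ((c, j) :: stk) (y :: vis) (denote search_step s).
Proof.
move=> new g_y.
rewrite search_step_forward lt_j denote_explore (negbTE new) g_y; cbv zeta iota.
have V := visE new.
rewrite (denote_push (n := size stk) (j := j) (o := num_open c) (y := index_of y)
  (q := num_open y) (t := t) (p := base j + c j) (r := removed c t)) //; first last.
- by rewrite /= (rp_rem rp).
- by rewrite /= (rp_ptr rp).
- by rewrite /= /upd /= (rp_o rp).
- by rewrite /= /upd /= (rp_j rp).
- by rewrite /= /upd /= (rp_sp rp).
case: rp => st _ _ _ _ go ans ptrE remE _ sr; split=> //.
- by apply: (static_repr_ext st).
- by rewrite /= addn1.
- move=> l; rewrite /= ptrE ffunE; case: eqP => [/val_inj->|ne_l].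
    by rewrite eqxx addn1 addnS.
  by case: eqP => // eq_l; rewrite eq_l in ne_l.
- move=> u; rewrite /= /y removed_inc // remE -/t.
  by case: eqP => [->|_]; rewrite ?addn1 ?addn0.
- split; rewrite /= ?eqxx //.
  by apply: stack_repr_ext sr => i lt_i /=; rewrite (ltn_eqF lt_i).
Qed.

End Forward.

Hypotheses (inv : search_inv c k stk vis) (rp : repr c k stk vis s).

Lemma denote_back :
    c != final I ->
  denote search_step s = if 0 < size stk then denote pop s else set_sc s vGo 0.
Proof.
move=> ne_c; rewrite /search_step (denote_if _ _ (b := true)); last first.
  by rewrite /= (test_final inv rp).
rewrite (denote_if _ _ (b := false)); last first.
  by rewrite /= (rp_k (rp_static rp)) (rp_j rp) subnn.
by rewrite (denote_if _ _ (b := 0 < size stk)) //= (rp_sp rp).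
Qed.

End Step.

Lemma repr_pop c c' (j : 'I_k) stk vis s :
    search_inv c k ((c', j) :: stk) vis -> repr c k ((c', j) :: stk) vis s ->
    c != final I ->
  repr c' j.+1 stk vis (denote search_step s).
Proof.
move=> inv rp ne_c; rewrite (denote_back inv rp) // [0 < _]/=.
have [eq_c lt_j _] := inv_chain inv; have [stkE savE _] := rp_stk rp.
pose t := next c' j.
rewrite (denote_pop (n := (size stk).+1) (j := j) (o := num_open c')
  (p := base j + c j) (t := t) (r := removed c t) (x := index_of c)
  (d := stride (len I) j)) ?subn1 //=; first last.
- by rewrite (rp_str (rp_static rp)).
- by rewrite (rp_x rp).
- by rewrite (rp_rem rp).
- rewrite eq_c incE addnS (rp_bin (rp_static rp)) //.
- by rewrite (rp_ptr rp).
- by rewrite (rp_sp rp).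
case: rp => st _ _ _ _ go ans ptrE remE visE [_ _ sr]; split=> //.
- by apply: (static_repr_ext st).
- by rewrite /= addn1.
- by rewrite /= /upd /= eq_c index_of_inc addnK.
- move=> l; rewrite /= ptrE eq_c incE ffunE; case: eqP => [/val_inj->|ne_l].
    by rewrite addnS.
  by case: eqP => // eq_l; rewrite eq_l in ne_l.
- move=> u; rewrite /= remE eq_c !removed_inc // -/t eqxx addn1.
  by case: eqP => [->|_]; rewrite ?addn0.
- by apply: stack_repr_ext sr.
Qed.

(** * Number of turns of the search loop *)

Lemma work_skip (j : 'I_k) (stk : seq (frame I)) vis :
  work j.+1 stk vis < work j stk vis.
Proof. by rewrite /work ltn_add2l; have := ltn_ord j; lia. Qed.

Lemma work_bad (j : 'I_k) (stk : seq (frame I)) y vis :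
  work j.+1 stk (y :: vis) < work j stk vis.
Proof.
apply: leq_trans (work_skip j stk vis); rewrite ltnS !leq_add2r leq_mul2r.
by rewrite leq_sub2l ?orbT.
Qed.

Lemma work_push (j : 'I_k) (stk : seq (frame I)) c y vis :
  size vis < stride (len I) k -> work 0 ((c, j) :: stk) (y :: vis) < work j stk vis.
Proof.
move=> lt_vis; rewrite /work big_cons /= -(subnSK lt_vis) mulSn.
by have := ltn_ord j; lia.
Qed.

Lemma work_pop (j : 'I_k) (stk : seq (frame I)) c vis :
  work j.+1 stk vis < work k ((c, j) :: stk) vis.
Proof. by rewrite /work big_cons /=; have := ltn_ord j; lia. Qed.

Definition search : cmd := While (Var vGo) search_step.

Definition turn_cost : nat := expr_cost (Var vGo) + 3 + cost search_step.

Lemma runs_search_turn s n s' :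
    sc s vGo = 1 -> runs search (denote search_step s) n s' ->
  runs search s (turn_cost + n) s'.
Proof.
move=> go_s; apply: runs_while_true; first by rewrite /= go_s.
exact: runs_denote.
Qed.

Lemma runs_search_end s :
    sc s vGo = 1 -> sc (denote search_step s) vGo = 0 ->
  runs search s (turn_cost + turn_cost) (denote search_step s).
Proof.
move=> go_s go_s'; apply: runs_search_turn go_s _.
apply: runs_leq (@runs_while_false (Var vGo) search_step _ go_s').
exact: leq_addr.
Qed.

(** Induction on a strict bound for the potential; the additional [turn_cost] pays for the failing
    test that leaves the loop. *)
Lemma runs_search n c j stk vis s :
    j <= k -> search_inv c j stk vis -> repr c j stk vis s -> work j stk vis < n ->
  exists2 s', runs search s (turn_cost * n.+1) s' & 0 < sc s' vAns <-> has_processing I.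
Proof.
elim: n c j stk vis s => // n IHn c j stk vis s le_j inv rp; rewrite ltnS => le_w.
(* A turn either continues with less potential ([next_turn]) or clears [vGo] with a correct answer
   ([stop]). *)
have next_turn c' j' stk' vis' : j' <= k -> search_inv c' j' stk' vis' ->
    repr c' j' stk' vis' (denote search_step s) -> work j' stk' vis' < work j stk vis ->
  exists2 s', runs search s (turn_cost * n.+2) s' & 0 < sc s' vAns <-> has_processing I.
  move=> le_j' inv' rp' /leq_trans/(_ le_w) lt_w.
  have [s' run_s' ans] := IHn _ _ _ _ _ le_j' inv' rp' lt_w.
  by exists s'; rewrite // mulnS; apply: runs_search_turn run_s'; exact: rp_go rp.
have stop : sc (denote search_step s) vGo = 0 ->
    (0 < sc (denote search_step s) vAns <-> has_processing I) ->
  exists2 s', runs search s (turn_cost * n.+2) s' & 0 < sc s' vAns <-> has_processing I.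
  move=> go0 ans; exists (denote search_step s) => //.
  apply: runs_leq (runs_search_end (rp_go rp) go0).
  by rewrite addnn -mul2n mulnC leq_mul2l orbT.
have [eq_c|ne_c] := eqVneq c (final I).
  have E : denote search_step s = set_sc (set_sc s vAns 1) vGo 0.
    rewrite /search_step (denote_if _ _ (b := false)) //.
    by rewrite /= (test_final inv rp) eq_c eqxx.
  rewrite E in stop; apply: stop => //; split=> // _.
  by apply/good_reach_final; rewrite -eq_c; exact: inv_reach inv.
move: le_j; rewrite leq_eqVlt => /predU1P[eq_j|lt_j].
  rewrite eq_j in inv rp next_turn.
  case: stk inv rp next_turn {le_w} => [|[c' l] stk] inv rp next_turn.
    have E : denote search_step s = set_sc s vGo 0 := denote_back inv rp ne_c.
    rewrite E in stop; apply: stop => //; rewrite /= /upd /= (rp_ans rp).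
    by split=> // /(search_inv_reject inv ne_c).
  apply: next_turn (search_inv_pop inv ne_c) (repr_pop inv rp ne_c) _ => //.
  exact: work_pop.
pose jj := Ordinal lt_j; rewrite -[j]/(nat_of_ord jj) in inv rp next_turn.
have [lt_c|nlt_c] := boolP (c jj < len I jj); last first.
  apply: next_turn (repr_skip inv rp ne_c (negbTE nlt_c)) _ => //; last exact: work_skip.
  by apply: search_inv_skip inv _; rewrite (negbTE nlt_c).
have [seen|new] := boolP (inc c jj \in vis).
  apply: next_turn (repr_seen inv rp ne_c lt_c seen) _ => //; last exact: work_skip.
  exact: search_inv_skip inv _.
have [g_y|bad] := boolP (good (inc c jj)).
  have inv' := search_inv_push inv ne_c lt_c new g_y.
  apply: next_turn (inv') (repr_push inv rp ne_c lt_c new g_y) _ => //.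
  (* The size bound for the enlarged visited list is the strict bound for the old one. *)
  exact/work_push/(search_inv_size inv').
apply: next_turn (search_inv_bad inv lt_c new bad)
  (repr_bad inv rp ne_c lt_c new bad) _ => //.
exact: work_bad.
Qed.

End Machine.

(** * Reading the input *)

Definition read_bin : cmd :=
  Input vT ;; Store aBin (Var vB) (Var vT) ;; incr_at aTot vT ;; incr vB ;;
  vS ::= Plus (Var vS) (Var vD) ;; decr vN.

(** [vD] freezes the stride of the sequence; adding it to [vS] once per bin multiplies [vS] by the
    length plus one. *)
Definition read_head : cmd :=
  Input vN ;; Store aPtr (Var vJ) (Var vB) ;; Store aStr (Var vJ) (Var vS) ;;
  vD ::= Var vS.

Definition read_tail : cmd := Store aEnd (Var vJ) (Var vB) ;; incr vJ.

Definition read_bins : cmd := While (Var vN) read_bin.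

Definition read_seqs : cmd :=
  While (Minus (Var vK) (Var vJ)) (read_head ;; read_bins ;; read_tail).

Definition bin_cost : nat := expr_cost (Var vN) + 3 + cost read_bin.

Lemma denote_read_bin s F x q rest :
    inp s = x :: q ++ rest -> sc s vN = (size q).+1 -> sc s vB = size F ->
    (forall i, ar s aBin i = nth 0 F i) ->
    (forall t, ar s aTot t = count_mem t F) ->
  let s' := denote read_bin s in
  [/\ inp s' = q ++ rest, sc s' vN = size q, sc s' vB = size (rcons F x),
      forall i, ar s' aBin i = nth 0 (rcons F x) i &
      forall t, ar s' aTot t = count_mem t (rcons F x)] /\
  [/\ sc s' vS = sc s vS + sc s vD,
      forall r, r \notin [:: vT; vB; vS; vN] -> sc s' r = sc s r &
      forall a, a \notin [:: aBin; aTot] -> forall i, ar s' a i = ar s a i].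
Proof.
move=> inpE nE bE binE totE; rewrite /= /upd /= inpE nE bE /=.
split; split=> //.
- by rewrite subn1.
- by rewrite size_rcons addn1.
- move=> i; rewrite nth_rcons binE; case: ltngtP => // lt_i.
  by rewrite nth_default // ltnW.
- move=> t; rewrite -cats1 count_cat /= !totE addn0 eq_sym.
  by case: eqP => [->|_]; rewrite ?addn0.
- move=> r; rewrite !inE !negb_or => /and4P[rT rB rS rN].
  by rewrite (negbTE rT) (negbTE rB) (negbTE rS) (negbTE rN).
- by move=> a; rewrite !inE negb_or => /andP[/negbTE-> /negbTE->] i.
Qed.

Lemma runs_read_bins s F q rest :
    inp s = q ++ rest -> sc s vN = size q -> sc s vB = size F ->
    (forall i, ar s aBin i = nth 0 F i) ->
    (forall t, ar s aTot t = count_mem t F) ->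
  exists2 s', runs read_bins s (bin_cost * (size q).+1) s' &
  [/\ inp s' = rest, sc s' vB = size (F ++ q),
      forall i, ar s' aBin i = nth 0 (F ++ q) i &
      forall t, ar s' aTot t = count_mem t (F ++ q)] /\
  [/\ sc s' vS = sc s vS + size q * sc s vD,
      forall r, r \notin [:: vT; vB; vS; vN] -> sc s' r = sc s r &
      forall a, a \notin [:: aBin; aTot] -> forall i, ar s' a i = ar s a i].
Proof.
elim: q s F => [|x q IHq] s F inpE nE bE binE totE.
  exists s; last by rewrite cats0; split; split=> //; rewrite addn0.
  apply: runs_leq (@runs_while_false (Var vN) read_bin _ nE).
  by rewrite muln1; exact: leq_addr.
have [[inp1 n1 b1 bin1 tot1] [s1 fr1 fa1]] := denote_read_bin inpE nE bE binE totE.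
have [s' run_s' [[inp2 b2 bin2 tot2] [s2 fr2 fa2]]] := IHq _ _ inp1 n1 b1 bin1 tot1.
exists s'.
  rewrite mulnS; apply: runs_while_true run_s'; first by rewrite /= nE.
  exact: runs_denote.
rewrite -cat_rcons; split; split=> //.
- by rewrite s2 s1 fr1 //= mulSn addnA.
- by move=> r nr; rewrite fr2 ?fr1.
- by move=> a na i; rewrite fa2 ?fa1.
Qed.

(** Loop invariant of the input phase. [pd_zero] and [pd_azero] retain the initial zeros on which
    the search relies, so its tables need no clearing. *)
Record parsed (k p : nat) (done : seq (seq nat)) (w : seq nat) (s : store) : Prop :=
  Parsed {
    pd_k : sc s vK = k;
    pd_p : sc s vP = p;
    pd_j : sc s vJ = size done;
    pd_b : sc s vB = size (flatten done);
    pd_s : sc s vS = \prod_(q <- done) (size q).+1;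
    pd_zero : forall r, r \in [:: vX; vO; vSp; vAns] -> sc s r = 0;
    pd_inp : inp s = w;
    pd_bin : forall i, ar s aBin i = nth 0 (flatten done) i;
    pd_tot : forall t, ar s aTot t = count_mem t (flatten done);
    pd_azero : forall a i, a \in [:: aRem; aVis] -> ar s a i = 0;
    pd_arr : forall l, l < size done ->
      [/\ ar s aPtr l = size (flatten (take l done)),
          ar s aEnd l = size (flatten (take l done)) + size (nth [::] done l) &
          ar s aStr l = \prod_(q <- take l done) (size q).+1]
  }.

(** The summand [bin_cost] pays for the failing test of the inner loop. *)
Definition seq_cost : nat :=
  expr_cost (Minus (Var vK) (Var vJ)) + 3 + cost read_head + bin_cost + cost read_tail.

Definition encode_seqs (L : seq (seq nat)) : seq nat :=
  flatten [seq size q :: q | q <- L].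

Lemma runs_read_seq k p done q w s :
    parsed k p done (size q :: q ++ w) s ->
  exists2 s', runs (read_head ;; read_bins ;; read_tail) s
                (cost read_head + (bin_cost * (size q).+1 + cost read_tail)) s' &
              parsed k p (rcons done q) w s'.
Proof.
move=> pd; pose n := size done.
pose s1 := set_sc (set_ar (set_ar (Sto (upd (sc s) vN (size q)) (ar s) (q ++ w))
  aPtr n (size (flatten done))) aStr n (\prod_(r <- done) (size r).+1))
  vD (\prod_(r <- done) (size r).+1).
have E1 : denote read_head s = s1.
  by rewrite /read_head /= /upd /= (pd_inp pd) (pd_j pd) (pd_b pd) (pd_s pd).
have [s2 run2 [[inp2 b2 bin2 tot2] [sE fr fa]]] :=
  @runs_read_bins s1 (flatten done) q w erefl erefl (pd_b pd) (pd_bin pd) (pd_tot pd).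
exists (denote read_tail s2).
  have run1 : runs read_head s (cost read_head) s1 by rewrite -E1; exact: runs_denote.
  by apply: runs_seq run1 (runs_seq run2 _); exact: runs_denote.
have j2 : sc s2 vJ = n by rewrite fr //= /upd /= (pd_j pd).
have F2 r : r \notin [:: vT; vB; vS; vN; vD] -> sc s2 r = sc s r.
  rewrite !inE !negb_or => /and5P[rT rB rS rN rD].
  by rewrite fr ?inE ?negb_or ?rT ?rB ?rS ?rN //= /upd (negbTE rN) (negbTE rD).
have A2 a i : a \notin [:: aBin; aTot; aPtr; aStr] -> ar s2 a i = ar s a i.
  rewrite !inE !negb_or => /and4P[aB aT aP aS].
  by rewrite fa ?inE ?negb_or ?aB ?aT //= (negbTE aP) (negbTE aS).
rewrite -cats1; split.
- by rewrite /= /upd /= F2 ?(pd_k pd).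
- by rewrite /= /upd /= F2 ?(pd_p pd).
- by rewrite /= /upd /= j2 size_cat addn1.
- by rewrite /= /upd /= b2 flatten_cat /= cats0.
- rewrite /= /upd /= sE /= /upd /= (pd_s pd) big_cat big_seq1 /=.
  by rewrite mulnS mulnC.
- move=> r r_in; rewrite -(pd_zero pd r_in) /= /upd.
  by move: r_in; rewrite !inE => /or4P[] /eqP->; rewrite /= F2.
- by rewrite /= inp2.
- by move=> i; rewrite /= bin2 flatten_cat /= cats0.
- by move=> t; rewrite /= tot2 flatten_cat /= cats0.
- move=> a i a_in; rewrite -(pd_azero pd i a_in) /=.
  by move: a_in; rewrite !inE => /orP[] /eqP->; rewrite /= A2.
- move=> l; rewrite size_cat addn1 ltnS leq_eqVlt => /predU1P[->|lt_l].
    rewrite take_size_cat // nth_cat ltnn subnn /= j2 b2 eqxx size_cat.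
    by rewrite fa //= fa //= eqxx.
  have [ptr_l end_l str_l] := pd_arr pd lt_l.
  rewrite takel_cat 1?ltnW // nth_cat lt_l /= j2 (ltn_eqF lt_l).
  by rewrite fa //= fa //= fa //= (ltn_eqF lt_l).
Qed.

Lemma runs_read_seqs k p done todo s :
    k = size (done ++ todo) -> parsed k p done (encode_seqs todo) s ->
  exists2 s', runs read_seqs s
                (seq_cost * (size todo).+1 + bin_cost * size (flatten todo)) s' &
              parsed k p (done ++ todo) [::] s'.
Proof.
elim: todo done s => [|q todo IHtodo] done s kE pd.
  exists s; last by rewrite cats0.
  have e0 : eval s (Minus (Var vK) (Var vJ)) = 0.
    by rewrite /= (pd_k pd) (pd_j pd) kE cats0 subnn.
  apply: runs_leq (@runs_while_false _ (read_head ;; read_bins ;; read_tail) _ e0).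
  by rewrite muln0 addn0 muln1 /seq_cost -!addnA !leq_add2l; lia.
have [s1 run1 pd1] := runs_read_seq pd.
rewrite -cat_rcons in kE *; have [s2 run2 pd2] := IHtodo _ _ kE pd1.
exists s2 => //; apply: runs_leq (runs_while_true _ run1 run2).
  rewrite -[flatten (q :: todo)]/(q ++ flatten todo) size_cat mulnDr.
  rewrite (mulnS seq_cost (size todo).+1) mulnS.
  by rewrite [X in _ <= X + _ + _]/seq_cost; lia.
by rewrite /= (pd_k pd) (pd_j pd) kE -cats1 !size_cat /=; lia.
Qed.

Definition init : cmd := Input vK ;; Input vP ;; vS ::= Num 1.

(** Entry 0 of [aVis] belongs to the initial configuration, whose index is 0. *)
Definition init_search : cmd :=
  Store aVis (Num 0) (Num 1) ;; vJ ::= Num 0 ;; vGo ::= Num 1.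

Definition stack_up : cmd := init ;; read_seqs ;; init_search ;; search.

Lemma parsed_init k p w :
  parsed k p [::] w (denote init (Sto (fun=> 0) (fun _ _ => 0) [:: k, p & w])).
Proof.
split=> //=; first by rewrite big_nil.
- by move=> r; rewrite !inE => /or4P[] /eqP->.
- by move=> i; rewrite nth_nil.
Qed.

Lemma strideE (I : instance) j : j <= nseqs I ->
  stride (len I) j = \prod_(q <- take j (symbols I)) (size q).+1.
Proof.
move=> le_j; rewrite (big_nth [::]) size_takel ?size_symbols // big_mkord.
by apply: eq_bigr => i _; rewrite nth_take.
Qed.

Lemma repr_init (I : instance) s :
    parsed (nseqs I) (places I) (symbols I) [::] s ->
  repr (initial I) 0 [::] [:: initial I] (denote init_search s).
Proof.
move=> pd; have szL := size_symbols I.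
have lt_L (j : 'I_(nseqs I)) : j < size (symbols I) by rewrite szL.
split=> //.
- split; rewrite /= /upd /=.
  + exact: pd_k pd.
  + exact: pd_p pd.
  + by rewrite (pd_s pd) strideE // -szL take_size.
  + by move=> j; have [_ -> _] := pd_arr pd (lt_L j).
  + by move=> j; have [_ _ ->] := pd_arr pd (lt_L j); rewrite strideE // ltnW.
  + move=> j i lt_i; rewrite (pd_bin pd) -{1}(cat_take_drop j (symbols I)).
    rewrite flatten_cat nth_cat /base ltnNge leq_addr /= addKn (drop_nth [::]) //=.
    by rewrite nth_cat lt_i.
  + exact: pd_tot pd.
- by rewrite /= /upd /= (pd_zero pd) // index_of_initial.
- by rewrite /= /upd /= (pd_zero pd) // num_open_initial.
- by rewrite /= /upd /= (pd_zero pd).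
- by rewrite /= /upd /= (pd_zero pd).
- by move=> j; rewrite /=; have [-> _ _] := pd_arr pd (lt_L j); rewrite ffunE addn0.
- by move=> t; rewrite /= (pd_azero pd) // removed_initial.
- move=> y b_y; rewrite /= mem_seq1 (pd_azero pd) //.
  rewrite -(inj_in_eq (@index_of_inj I)) ?index_of_initial //.
  exact: bounded_initial.
Qed.

Lemma encodeE (I : instance) :
  encode I = [:: nseqs I, places I & encode_seqs (symbols I)].
Proof.
rewrite /encode /encode_seqs -map_comp; congr [:: _, _ & flatten _].
by apply: eq_map => q /=; rewrite size_map.
Qed.

(** * Total cost *)

Definition step_bound : nat :=
  cost init + 2 * seq_cost + bin_cost + cost init_search + turn_cost * 6 + 2.

Lemma runs_stack_up (I : instance) :
  exists2 s, 0 < sc s vAns <-> has_processing I &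
    runs stack_up (Sto (fun=> 0) (fun _ _ => 0) (encode I))
      (cost init + (seq_cost * (nseqs I).+1 + bin_cost * size (flatten (symbols I)) +
        (cost init_search +
         turn_cost * (stride (len I) (nseqs I) * (nseqs I).+1 + nseqs I).+2))) s.
Proof.
have pd0 := parsed_init (nseqs I) (places I) (encode_seqs (symbols I)).
have [|s1 run1 pd1] := runs_read_seqs _ pd0; first by rewrite size_symbols.
have rp := repr_init pd1.
have [||s2 run2 ans] :=
  runs_search (n := (stride (len I) (nseqs I) * (nseqs I).+1 + nseqs I).+1) _
    (search_inv_initial I) rp => //.
  by rewrite /work big_nil addn0 subn0 ltnS leq_add2r leq_mul2r leq_subr orbT.
rewrite size_symbols in run1.
have run0 := @runs_denote init (Sto (fun=> 0) (fun _ _ => 0) (encode I)) isT.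
have run_i := @runs_denote init_search s1 isT.
exists s2 => //; rewrite encodeE in run0 *.
exact: runs_seq run0 (runs_seq run1 (runs_seq run_i run2)).
Qed.

Lemma stride_leq_maxlen (I : instance) :
  stride (len I) (nseqs I) <= (maxlen I + 1) ^ nseqs I.
Proof.
rewrite -[X in _ <= _ ^ X]card_ord -prod_nat_const; apply: leq_prod => j _.
by rewrite len_sq addn1 ltnS /maxlen (leq_bigmax j).
Qed.

Lemma size_symbols_leq (I : instance) :
  size (flatten (symbols I)) <= nseqs I * maxlen I.
Proof.
rewrite size_flatten sumnE big_map (big_nth [::]) size_symbols big_mkord.
rewrite -[X in _ <= X * _]card_ord -sum_nat_const; apply: leq_sum => j _.
by rewrite -/(len I j) len_sq /maxlen (leq_bigmax j).
Qed.

(** [X] stands for the target [k * (N+1)^k]; as it is positive, additive constants are absorbed too.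
    This is the origin of the factors in [step_bound]. *)
Lemma cost_arith a b c d e k f x X :
    0 < X -> k <= X -> f <= X -> x <= 2 * X ->
  a + (b * k.+1 + c * f + (d + e * (x + k).+2)) + 2
    <= (a + 2 * b + c + d + e * 6 + 2) * X.
Proof.
move=> X_gt0 le_k le_f le_x.
have le_b : b * k.+1 <= b * (2 * X) by rewrite leq_mul2l; apply/orP; right; lia.
have le_c : c * f <= c * X by rewrite leq_mul2l le_f orbT.
have le_e : e * (x + k).+2 <= e * (6 * X) by rewrite leq_mul2l; apply/orP; right; lia.
have le_a : a <= a * X by rewrite leq_pmulr.
have le_d : d <= d * X by rewrite leq_pmulr.
rewrite !mulnDl -!mulnA; move: le_b; rewrite (mulnCA b).
by lia.
Qed.

Lemma cost_leq (I : instance) :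
  cost init + (seq_cost * (nseqs I).+1 + bin_cost * size (flatten (symbols I)) +
    (cost init_search +
     turn_cost * (stride (len I) (nseqs I) * (nseqs I).+1 + nseqs I).+2)) + 2
  <= step_bound * (nseqs I * (maxlen I + 1) ^ nseqs I).
Proof.
have k_gt0 := nseqs_gt0 I; set k := nseqs I in k_gt0 *.
set N := (maxlen I + 1) ^ k; pose X := k * N.
have le_s : stride (len I) k <= N := stride_leq_maxlen I.
have N_gt0 : 0 < N by rewrite expn_gt0 addn1.
(* As [k] is positive, one factor of the power is available to absorb the length of the input. *)
have le_m : maxlen I + 1 <= N by rewrite -{1}[maxlen I + 1]expn1 leq_pexp2l // addn1.
have le_b : size (flatten (symbols I)) <= X.
  apply: leq_trans (size_symbols_leq I) _; rewrite leq_mul2l; apply/orP; right.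
  by apply: leq_trans le_m; exact: leq_addr.
have X_gt0 : 0 < X by rewrite muln_gt0 k_gt0.
have le_k : k <= X by rewrite leq_pmulr.
have le_X : stride (len I) k * k.+1 <= 2 * X.
  by apply: leq_trans (leq_mul le_s (_ : k.+1 <= 2 * k)) _; rewrite /X; nia.
exact: cost_arith.
Qed.

Theorem theorem3 :
  exists (P : program) (C : nat), forall I : instance,
    exists b : bool,
      run P (C * (nseqs I * (maxlen I + 1) ^ nseqs I)) (start (encode I))
        = Some b
      /\ (b <-> has_processing I).
Proof.
exists (decider stack_up vAns), step_bound => I.
have [s ans run_s] := runs_stack_up I.
exists (0 < sc s vAns); split=> //.
by apply: run_leq (cost_leq I) _; apply: run_decider run_s.
Qed.
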